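(* Thompson's group $F = \langle x_0, x_1 \mid [x_0x_1^{-1}, x_0^{-1}x_1x_0],\ [x_0x_1^{-1}, x_0^{-2}x_1x_0^{2}] \rangle$ does not satisfy Cannon's almost convexity condition $AC(2)$ with respect to the generating set $\{x_0, x_1\}$.
   Context: Let $G$ be a group with finite generating set $X$, let $d_X$ be the word metric on $G$ (distance in the Cayley graph whose edges join $g$ and $gx^{\pm1}$, $x\in X$), and let $B(n)$ be the ball of radius $n$ about the identity. For a positive integer $k$, $G$ is almost convex $(k)$, or $AC(k)$, with respect to $X$ if there is a number $N(k)$ such that for all positive integers $n$ and all $y,z \in B(n)$ with $d_X(y,z)\le k$ there is a path in the Cayley graph from $y$ to $z$ of length at most $N(k)$ lying entirely in $B(n)$. Here $[a,b]$ denotes the commutator of $a$ and $b$. Equivalently, $F$ is the group with infinite presentation $\langle x_k,\ k\ge 0 \mid x_i^{-1}x_jx_i = x_{j+1} \text{ for } i<j\rangle$, with the same $x_0,x_1$. *)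

(* Defs.v *)
From HB Require Import structures.
From mathcomp Require Import all_boot boolp.

Set Implicit Arguments.
Unset Strict Implicit.
Unset Printing Implicit Defensive.

Local Open Scope quotient_scope.
Local Open Scope group_scope.

Section CayleyGraph.

Variables (G : groupType) (X : seq G).

Definition generating : Prop :=
  forall g : G, exists2 s : seq G,
    all (fun x => (x \in X) || (x^-1 \in X)) s & g = \prod_(x <- s) x.

Definition cayley : rel G :=
  fun g h => has (fun x => (h == g * x) || (h == g * x^-1)) X.

Definition joined (g h : G) (n : nat) : Prop :=
  exists p : seq G, [/\ path cayley g p, last g p = h & size p = n].

Hypothesis genX : generating.

Lemma joined_exists (g h : G) : exists n, `[< joined g h n >].
Proof.
have [s] := genX (g^-1 * h).
elim: s g => [|x s IHs] g /=.
  rewrite big_nil => _ gh; exists 0; apply/asboolP; exists [::]; split=> //=.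
  by rewrite -[h](mulVKg g) gh mulg1.
case/andP=> Xx Xs gh.
have [|n /asboolP[p [pP pl ps]]] := IHs (g * x) Xs.
  by rewrite invgM -mulgA gh big_cons mulKg.
exists n.+1; apply/asboolP; exists (g * x :: p); split=> //=; last by rewrite ps.
rewrite pP andbT; apply/hasP.
by case/orP: Xx => Xx; [exists x | exists x^-1]; rewrite // ?invgK eqxx ?orbT.
Qed.

Definition word_metric (g h : G) : nat := ex_minn (joined_exists g h).

Definition ball (n : nat) : pred G := fun g => word_metric 1 g <= n.

(* A path lies in the ball when all of its vertices, endpoints included, do. *)
Definition almost_convex (k : nat) : Prop :=
  exists N : nat, forall n : nat, 0 < n ->
    forall y z : G, ball n y -> ball n z -> word_metric y z <= k ->
    exists p : seq G,
      [/\ path cayley y p, last y p = z, size p <= N & all (ball n) (y :: p)].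

End CayleyGraph.

(* [(t, false)] stands for the generator [t] and [(t, true)] for its inverse. *)
Definition word (T : Type) := seq (T * bool).

Definition wgen (T : Type) (t : T) : word T := [:: (t, false)].

Definition winv (T : Type) (w : word T) : word T :=
  rev [seq (a.1, ~~ a.2) | a <- w].

(* u^-1 v^-1 u v; as a relator it is equivalent to u v u^-1 v^-1, both saying
   that u and v commute. *)
Definition wcomm (T : Type) (u v : word T) : word T :=
  winv u ++ winv v ++ u ++ v.

Lemma winvK (T : Type) : involutive (@winv T).
Proof.
by elim=> [|[t b] w IHw] //; rewrite /winv /= rev_cons map_rcons rev_rcons
  -/(winv _) IHw /= negbK.
Qed.

Section Presentation.

Variables (T : choiceType) (R : seq (word T)).

(* The least congruence on words that makes (t, b) and (t, ~~ b) mutually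
   inverse and kills R: its quotient is the free group on T modulo the normal
   closure of R. *)
Inductive pres_eq : word T -> word T -> Prop :=
| pres_refl w : pres_eq w w
| pres_sym v w : pres_eq v w -> pres_eq w v
| pres_trans u v w : pres_eq u v -> pres_eq v w -> pres_eq u w
| pres_cat u u' v v' : pres_eq u u' -> pres_eq v v' -> pres_eq (u ++ v) (u' ++ v')
| pres_cancel t b : pres_eq [:: (t, b); (t, ~~ b)] [::]
| pres_rel r : r \in R -> pres_eq r [::].

Definition pres_eqb : rel (word T) := fun v w => `[< pres_eq v w >].

Lemma pres_eqb_refl : reflexive pres_eqb.
Proof. by move=> w; apply/asboolP/pres_refl. Qed.

Lemma pres_eqb_sym : symmetric pres_eqb.
Proof. by move=> v w; apply/asboolP/asboolP => /pres_sym. Qed.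

Lemma pres_eqb_trans : transitive pres_eqb.
Proof.
by move=> v u w /asboolP uv /asboolP vw; apply/asboolP/(pres_trans uv vw).
Qed.

Canonical pres_equiv := EquivRel pres_eqb pres_eqb_refl pres_eqb_sym pres_eqb_trans.

Definition presented := {eq_quot pres_equiv}.
HB.instance Definition _ : EqQuotient _ pres_equiv presented := EqQuotient.on presented.
HB.instance Definition _ := Choice.on presented.

Lemma pres_ind (P : presented -> Prop) :
  (forall w, P (\pi_presented w)) -> forall g, P g.
Proof. by move=> Pw g; rewrite -[g]reprK. Qed.

Lemma pres_eqP v w : reflect (pres_eq v w) (v == w %[mod presented]).
Proof. by rewrite eqmodE; apply: asboolP. Qed.

Lemma pres_catV w : pres_eq (w ++ winv w) [::].
Proof.
elim: w => [|[t b] w IHw]; first exact: pres_refl.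
rewrite /winv /= rev_cons -cats1 -/(winv w); apply: pres_trans (pres_cancel t b).
have := pres_cat (pres_refl [:: (t, b)])
  (pres_cat IHw (pres_refl [:: (t, ~~ b)])).
by rewrite /= -catA.
Qed.

Lemma pres_catVl w : pres_eq (winv w ++ w) [::].
Proof. by rewrite -[X in _ ++ X]winvK; apply: pres_catV. Qed.

Lemma pres_eq_winv v w : pres_eq v w -> pres_eq (winv v) (winv w).
Proof.
move=> vw; apply: (@pres_trans _ (winv v ++ (w ++ winv w))).
  rewrite -[X in pres_eq X _]cats0; apply: pres_cat (pres_refl _) (pres_sym _).
  exact: pres_catV.
rewrite catA -[X in pres_eq _ X]cat0s; apply: pres_cat (pres_refl _).
apply: pres_trans (pres_catVl v).
exact: pres_cat (pres_refl _) (pres_sym vw).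
Qed.

Definition pres_one : presented := \pi_presented [::].
Definition pres_inv (g : presented) : presented := \pi_presented (winv (repr g)).
Definition pres_mul (g h : presented) : presented := \pi_presented (repr g ++ repr h).

Lemma pi_pres_inv w : pres_inv (\pi_presented w) = \pi_presented (winv w).
Proof.
by apply/eqP/pres_eqP/pres_eq_winv/pres_eqP; rewrite reprK.
Qed.

Lemma pi_pres_mul v w : pres_mul (\pi_presented v) (\pi_presented w) = \pi_presented (v ++ w).
Proof.
by apply/eqP/pres_eqP/pres_cat; apply/pres_eqP; rewrite reprK.
Qed.

Lemma pres_mulA : associative pres_mul.
Proof.
elim/pres_ind=> u; elim/pres_ind=> v; elim/pres_ind=> w.
by rewrite !pi_pres_mul catA.
Qed.

Lemma pres_mul1 : left_id pres_one pres_mul.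
Proof. by elim/pres_ind=> w; rewrite pi_pres_mul. Qed.

Lemma pres_mulr1 : right_id pres_one pres_mul.
Proof. by elim/pres_ind=> w; rewrite pi_pres_mul cats0. Qed.

Lemma pres_mulrV : right_inverse pres_one pres_inv pres_mul.
Proof.
elim/pres_ind=> w; rewrite pi_pres_inv pi_pres_mul.
exact/eqP/pres_eqP/pres_catV.
Qed.

Lemma pres_mulV : left_inverse pres_one pres_inv pres_mul.
Proof.
elim/pres_ind=> w; rewrite pi_pres_inv pi_pres_mul.
exact/eqP/pres_eqP/pres_catVl.
Qed.

HB.instance Definition _ := isGroup.Build presented
  pres_mulA pres_mul1 pres_mulr1 pres_mulV pres_mulrV.

Definition pgen (t : T) : presented := \pi_presented (wgen t).

End Presentation.

(* [false] indexes x0 and [true] indexes x1. *)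
Definition thompson_relators : seq (word bool) :=
  let x0 := wgen false in
  let x1 := wgen true in
  [:: wcomm (x0 ++ winv x1) (winv x0 ++ x1 ++ x0);
      wcomm (x0 ++ winv x1) (winv x0 ++ winv x0 ++ x1 ++ x0 ++ x0)].

Definition thompsonF : groupType := presented thompson_relators.

Definition thompson_x0 : thompsonF := pgen thompson_relators false.
Definition thompson_x1 : thompsonF := pgen thompson_relators true.

Lemma thompsonF_generating : generating [:: thompson_x0; thompson_x1].
Proof.
elim/pres_ind; elim=> [|[t b] w [s sX sw]]; first by exists [::]; rewrite ?big_nil.
pose x := if t then thompson_x1 else thompson_x0.
exists ((if b then x^-1 else x) :: s).
  rewrite /= sX andbT /x !inE.
  by case: {x} b; case: t; rewrite ?invgK eqxx ?orbT.
rewrite big_cons -sw -[(t, b) :: w]cat1s -pi_pres_mul; congr (_ * _).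
by rewrite /x; case: {x} b; case: t; rewrite // [RHS]pi_pres_inv.
Qed.

(* Main.v *)
Require Import Defs.
From mathcomp Require Import all_boot.
From mathcomp Require Import boolp.
From mathcomp Require Import all_order all_algebra zify ring lra.

Set Implicit Arguments.
Unset Strict Implicit.
Unset Printing Implicit Defensive.

Import Order.TTheory GRing.Theory Num.Theory.
Local Open Scope ring_scope.

(** Why F is not almost convex.

    F acts on the right on the rational line: x0 is p |-> p + 1, and x1 fixes
    every p <= 0, doubles [0, 1] and adds 1 beyond 1.  Applying the letters of
    a word one after the other is like running a tape, cut into the unit cells
    ]k - 1, k], under a head that stays at 0.  The letters x0 and x0^-1 slide
    the tape; x1 splits the cell just right of the head and x1^-1 merges the two
    cells just right of it.  Nothing left of the head is altered.

    Let h be the product of two commuting elements.  The hook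
    x0^(m+1) x1^-1 x0^-m merges the two cells that meet at the point -m and is
    the identity right of -m + 1; the comb (x1 x0^-1)^M x0^M, which is
    x_1 x_2 ... x_M, cuts the cell ]0, 1] at the points q_j = 1 - 2^-j for
    j <= M and is the identity left of 0.  To produce h the head has to visit
    both far ends of the tape and come back to 0, in either order, and h has
    length 2m + 3M.  If the head may stop one cell short of 0, on the side from
    which it arrives, one letter is saved.  Thus z = h x0 and y = h x0^-1, which
    are at distance at most 2, have length at most n = 2m + 3M - 1.

    A short path from y to z changes the tape near the head only, so that the
    work at both far ends remains done, and at some vertex the head passes
    between the left points -m, ..., 0 and the right points q_1, ..., q_M
    ([path_crossing]).  By [word_lower_bound] that vertex has length at least
    2m + 3M: the path has left the ball of radius n.

    The lower bound is a count of letters.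
    - Left end: until the point -m first gets right of the head, it is moved by
      x0^{+-1} alone, so x0 occurs m + 1 times more often than x0^-1.  After
      that, the m + 1 left points must get back to the left of the head.  One
      letter x0^-1 carries back one cell, and several points share a cell only
      if some x1^-1 has merged their cells.  This makes m + 1 more letters.
    - Right end: each q_j needs its own letter x1, to become an integer for the
      first time.  Just before, the head stands exactly at q_(j-1)
      ([dyadic_step]), which the cut of q_(j-1) had left on the right of the
      head; so a letter x0^-1 has moved q_(j-1) across the head in between.
      Coming back costs again one letter x0 for each cell, or a merging x1^-1.
      This makes M + (M - 1) + (M - 1) letters.
    No letter is counted twice, since all left points precede all right points,
    and so at most one cell contains points of both kinds.
    The count is made by induction on the word ([phase_act]): in each of the
    four situations of [phase], a suitable quantity drops by at most 1 for each
    letter that is read. *)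

(** * Piecewise linear action on the line *)

Notation letter := (bool * bool)%type.

Definition step (a : letter) (p : rat) : rat :=
  match a with
  | (false, false) => p + 1
  | (false, true) => p - 1
  | (true, false) => if p <= 0 then p else if p <= 1 then p * 2 else p + 1
  | (true, true) => if p <= 0 then p else if p <= 2 then p / 2 else p - 1
  end.

Definition act (w : word bool) (p : rat) : rat := foldl (fun q a => step a q) p w.

(** Innermost tests come first, so that the hypotheses produced by the case
    analysis contain no conditional. *)
Ltac pl_lra :=
  repeat match goal with |- context [if ?x <= ?k then _ else _] =>
    lazymatch x with
    | context [if _ then _ else _] => fail
    | _ => case: (lerP x k) => ?
    end
  end; lra.

Lemma act_cat u v p : act (u ++ v) p = act v (act u p).
Proof. exact: foldl_cat. Qed.

Lemma act_rcons w a p : act (rcons w a) p = step a (act w p).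
Proof. exact: foldl_rcons. Qed.

Lemma step_lt a p q : p < q -> step a p < step a q.
Proof.
by move=> pq; case: a => [[] []] /=; pl_lra.
Qed.

Lemma act_lt w p q : p < q -> act w p < act w q.
Proof. by elim: w p q => [|a w IHw] p q //= pq; apply/IHw/step_lt. Qed.

Lemma act_le w p q : p <= q -> act w p <= act w q.
Proof. by rewrite le_eqVlt => /predU1P[-> //|pq]; apply/ltW/act_lt. Qed.

Lemma step_cancel t b p : step (t, ~~ b) (step (t, b) p) = p.
Proof. by case: t b => [] [] /=; pl_lra. Qed.

Lemma act_winvK w p : act (winv w) (act w p) = p.
Proof.
elim: w p => [|[t b] w IHw] p //=.
by rewrite /winv /= rev_cons -/(winv w) act_rcons IHw step_cancel.
Qed.

Definition x0w : word bool := wgen false.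
Definition x1w : word bool := wgen true.

Lemma act_wcomm u v :
  (forall p, act (u ++ v) p = act (v ++ u) p) ->
  forall p, act (wcomm u v) p = p.
Proof.
move=> uv p; rewrite /wcomm catA act_cat uv -act_cat.
have -> : (winv u ++ winv v) ++ v ++ u = winv (v ++ u) ++ winv (winv (v ++ u)).
  by rewrite winvK /winv map_cat rev_cat.
by rewrite act_cat act_winvK.
Qed.

(** Monotonicity keeps each side of c invariant, because c is fixed by both
    words; so on either side one of the two words acts trivially. *)
Lemma act_disjoint u v c : (forall p, p <= c -> act v p = p) ->
  (forall p, c <= p -> act u p = p) ->
  forall p, act (u ++ v) p = act (v ++ u) p.
Proof.
move=> vc uc p; rewrite !act_cat; case: (lerP p c) => pc.
  by rewrite (vc p) // vc // -(uc c) // act_le.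
by rewrite (uc p) ?ltW // uc // -(vc c) // act_le // ltW.
Qed.

(** x0 x1^-1 is the identity on [1, +oo[, while the conjugates of x1 by x0 and
    x0^2 are the identity on ]-oo, 1]. *)
Lemma act_relator r p : r \in thompson_relators -> act r p = p.
Proof.
rewrite !inE => /orP[] /eqP ->; move: p; apply: act_wcomm;
  apply: (@act_disjoint _ _ 1) => p ?; rewrite /act /=;
  pl_lra.
Qed.

Lemma pres_eq_act u v p : pres_eq thompson_relators u v -> act u p = act v p.
Proof.
move=> uv; elim: uv p => {u v} //
  [u w v _ uw _ wv p|u u' v v' _ uu' _ vv' p|t b p|r rR p].
- by rewrite uw wv.
- by rewrite !act_cat uu' vv'.
- exact: step_cancel.
- exact: act_relator.
Qed.

(** * Words and the group *)

Local Open Scope quotient_scope.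

Definition eval (w : word bool) : thompsonF := \pi_(presented thompson_relators) w.

Definition gact (g : thompsonF) : rat -> rat :=
  act (repr (g : presented thompson_relators)).

Lemma eval_surj g : exists w, g = eval w.
Proof. by elim/pres_ind: g => w; exists w. Qed.

Lemma gact_eval w p : gact (eval w) p = act w p.
Proof. by apply/pres_eq_act/pres_eqP; rewrite reprK. Qed.

Lemma eval_cat u v : eval (u ++ v) = (eval u * eval v)%g.
Proof. by rewrite [RHS]pi_pres_mul. Qed.

Lemma eval_winv u : eval (winv u) = (eval u)^-1%g.
Proof. by rewrite [RHS]pi_pres_inv. Qed.

Lemma eval_relator r : r \in thompson_relators -> eval r = 1%g.
Proof. by move=> rR; apply/eqP/pres_eqP/pres_rel. Qed.

Lemma gactM g h p : gact (g * h)%g p = gact h (gact g p).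
Proof.
case: (eval_surj g) (eval_surj h) => u -> [v ->].
by rewrite -eval_cat !gact_eval act_cat.
Qed.

Notation X := [:: thompson_x0; thompson_x1].

Lemma cayleyP g h : reflect (exists a, h = (g * eval [:: a])%g) (cayley X g h).
Proof.
have e0 : eval [:: (false, true)] = (thompson_x0^-1)%g by exact: (eval_winv x0w).
have e1 : eval [:: (true, true)] = (thompson_x1^-1)%g by exact: (eval_winv x1w).
apply: (iffP idP) => [|[[t b] ->]].
  rewrite /cayley /= orbF => /orP[] /orP[] /eqP ->.
  - by exists (false, false).
  - by exists (false, true); rewrite e0.
  - by exists (true, false).
  - by exists (true, true); rewrite e1.
by case: t b => [] []; rewrite /cayley /= ?e0 ?e1 eqxx ?orbT.
Qed.

Lemma joined_eval g w : joined X g (g * eval w)%g (size w).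
Proof.
elim: w g => [|a w IHw] g.
  by exists [::]; split=> //=; rewrite [eval [::]](_ : _ = 1%g) ?mulg1.
have [p [pP pl ps]] := IHw (g * eval [:: a])%g.
exists ((g * eval [:: a])%g :: p); split=> /=.
- by rewrite pP andbT; apply/cayleyP; exists a.
- by rewrite pl -mulgA -eval_cat.
- by rewrite ps.
Qed.

Lemma path_eval g p : path (cayley X) g p ->
  exists w, size w = size p /\ last g p = (g * eval w)%g.
Proof.
elim: p g => [|h p IHp] g /=.
  by exists [::]; split=> //; rewrite [eval [::]](_ : _ = 1%g) ?mulg1.
case/andP=> /cayleyP[a ->] /IHp[w [ws ->]]; exists (a :: w).
by rewrite -cat1s eval_cat mulgA /= ws.
Qed.

Lemma word_metric_le g w n : (size w <= n)%N ->
  (word_metric thompsonF_generating g (g * eval w)%g <= n)%N.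
Proof.
apply: leq_trans; rewrite /word_metric; case: ex_minnP => k _; apply.
exact/asboolP/joined_eval.
Qed.

Lemma ballP n g :
  reflect (exists2 w, (size w <= n)%N & g = eval w) (ball thompsonF_generating n g).
Proof.
have mul1 w : (1 * eval w)%g = eval w by rewrite mul1g.
apply: (iffP idP) => [|[w ws ->]]; last by rewrite /ball -(mul1 w) word_metric_le.
rewrite /ball /word_metric; case: ex_minnP => k /asboolP[p [pP pl ps]] _ kn.
have [w [ws gw]] := path_eval pP; exists w; first by rewrite ws ps.
by rewrite -pl gw mul1g.
Qed.

(** * Commutation relations in F *)

Section ConjugateChain.
Local Open Scope group_scope.

Lemma commute_conjP (G : groupType) (a b y : G) :
  commute (a * b^-1) y <-> y ^ b = y ^ a.
Proof.
split=> [c | e]; last by rewrite /commute [RHS]conjgC conjgM -e conjgK.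
apply: (@conjg_inj _ b^-1); rewrite -[RHS]conjgM conjgK.
by apply: (mulgI (a * b^-1)); rewrite -[RHS]conjgC.
Qed.

(** The standard derivation of the infinite presentation from two relators.
    Write y_j for b conjugated by a^j.  Commuting with a b^-1 says that b
    conjugates y_j to y_(j+1).  The case j = 1, conjugated by powers of a, gives
    y_(i+1)^(y_i) = y_(i+2), so that conjugating this relation by b propagates
    the property from j and j + 1 to j + 2. *)
Lemma commute_conj_chain (G : groupType) (a b : G) :
    commute (a * b^-1) (b ^ (a ^+ 1)) -> commute (a * b^-1) (b ^ (a ^+ 2)) ->
  forall j, commute (a * b^-1) (b ^ (a ^+ j.+1)).
Proof.
pose y j := b ^ (a ^+ j); rewrite -/(y 1%N) -/(y 2%N) => c1 c2.
have yJ i j : y i ^ (a ^+ j) = y (i + j)%N by rewrite /y -conjgM -expgnDr.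
have cE j : commute (a * b^-1) (y j) <-> y j ^ b = y j.+1.
  by rewrite -addn1 -(yJ j 1%N) expg1; apply: commute_conjP.
have rel i : y i.+1 ^ y i = y i.+2.
  have /cE/(congr1 (conjg^~ (a ^+ i))) := c1.
  by rewrite conjJg !yJ add1n add2n.
suff conjb j : y j.+1 ^ b = y j.+2 /\ y j.+2 ^ b = y j.+3.
  by move=> j; apply/cE; case: (conjb j).
elim: j => [|j [IH1 IH2]]; first by split; apply/cE.
by split=> //; rewrite -[in LHS](rel j.+1) conjJg IH1 IH2 rel.
Qed.

End ConjugateChain.

(** The word (x1 x0^-1)^k x1 x0^j.  Since the return x0^j is a parameter, the
    same definition gives the comb whose head comes back to 0 (j = k) and the
    shorter words that stop earlier; similarly for [hook]. *)
Definition comb (k j : nat) : word bool :=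
  flatten (nseq k [:: (true, false); (false, true)])
  ++ (true, false) :: nseq j (false, false).

Definition hook (i j : nat) : word bool :=
  nseq i (false, false) ++ (true, true) :: nseq j (false, true).

Lemma size_comb k j : size (comb k j) = (2 * k + 1 + j)%N.
Proof.
rewrite size_cat size_flatten /shape map_nseq sumn_nseq /= size_nseq; lia.
Qed.

Lemma size_hook i j : size (hook i j) = (i + 1 + j)%N.
Proof. rewrite size_cat /= !size_nseq; lia. Qed.

Section CombHook.
Local Open Scope group_scope.
Local Notation a := thompson_x0.
Local Notation b := thompson_x1.

Lemma eval_nil : eval [::] = 1. Proof. by []. Qed.

Lemma eval_letter t c : eval [:: (t, c)] =
  let g := if t then b else a in if c then g^-1 else g.
Proof.
case: t c => [] [] //=.
- exact: (eval_winv x1w).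
- exact: (eval_winv x0w).
Qed.

Lemma eval_cons t c w : eval ((t, c) :: w) =
  (let g := if t then b else a in if c then g^-1 else g) * eval w.
Proof. by rewrite -cat1s eval_cat eval_letter. Qed.

Lemma eval_nseq k (x : letter) : eval (nseq k x) = eval [:: x] ^+ k.
Proof.
by elim: k => // k IHk; rewrite expgS -IHk -eval_cat.
Qed.

Lemma eval_comb k j : eval (comb k j) = (b * a^-1) ^+ k * b * a ^+ j.
Proof.
rewrite /comb eval_cat eval_cons eval_nseq eval_letter -mulgA; congr (_ * _).
elim: k => // k IHk.
by rewrite expgS -IHk /= !eval_cons /= mulgA.
Qed.

Lemma eval_hook i j : eval (hook i j) = a ^+ i * b^-1 * a ^- j.
Proof.
by rewrite eval_cat eval_cons !eval_nseq !eval_letter /= expVgn mulgA.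
Qed.

Lemma eval_wcomm u v : wcomm u v \in thompson_relators -> commute (eval u) (eval v).
Proof.
move/eval_relator; rewrite /wcomm !eval_cat !eval_winv mulgA -invgM.
by move/mulg1_eq; rewrite invgK.
Qed.

Lemma commute_thompson j : commute (a * b^-1) (b ^ (a ^+ j.+1)).
Proof.
have eqab : eval (x0w ++ winv x1w) = a * b^-1 by rewrite eval_cat eval_winv.
apply: commute_conj_chain; rewrite -eqab.
  have -> : b ^ (a ^+ 1) = eval (winv x0w ++ x1w ++ x0w).
    by rewrite !eval_cat eval_winv expg1.
  by apply: eval_wcomm; rewrite !inE eqxx.
have -> : b ^ (a ^+ 2) = eval (winv x0w ++ winv x0w ++ x1w ++ x0w ++ x0w).
  by rewrite !eval_cat eval_winv conjgE !expgS expg0 mulg1 invgM !mulgA.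
by apply: eval_wcomm; rewrite !inE eqxx orbT.
Qed.

(** The hook is a conjugate of x0 x1^-1 by a negative power of x0, and the comb
    is a product of conjugates of x1 by nonnegative powers of x0. *)
Lemma comb_hook_commute k l :
  commute (eval (comb k k)) (eval (hook l.+2 l.+1)).
Proof.
have -> : eval (hook l.+2 l.+1) = (a * b^-1) ^ (a ^- l.+1).
  by rewrite eval_hook conjgE invgK expgSr !mulgA.
set d := _ ^ _.
have dcomm j : commute d (b ^ (a ^+ j)).
  apply: (@conjg_inj _ (a ^+ l.+1)).
  rewrite (conjMg d) (conjMg _ d) /d conjgKV -conjgM -expgnDr addnS.
  exact: commute_thompson.
have -> : eval (comb k k) =
    (b * a^-1) ^+ k * a ^+ k * b ^ (a ^+ k).
  by rewrite eval_comb conjgE !mulgA mulgK.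
apply: commute_sym; apply: commuteM => //.
elim: k => [|k IHk]; first by rewrite !expg0 mulg1; apply: commute1.
have -> : (b * a^-1) ^+ k.+1 * a ^+ k.+1 =
    (b * a^-1) ^+ k * a ^+ k * b ^ (a ^+ k).
  by rewrite expgSr (expgS a) conjgE !mulgA mulgK mulgVK.
exact: commuteM.
Qed.
End CombHook.

(** * Powers of one half *)

Definition half_pow (j : nat) : rat := (1 / 2) ^+ j.

Lemma half_powS j : half_pow j.+1 = half_pow j / 2.
Proof. by rewrite /half_pow exprSr div1r. Qed.

Lemma half_pow0 : half_pow 0 = 1.
Proof. exact: expr0. Qed.

Lemma half_pow1 : half_pow 1 = 1 / 2.
Proof. exact: expr1. Qed.

Lemma half_pow_gt0 j : 0 < half_pow j.
Proof. by apply: exprn_gt0; lra. Qed.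

Lemma half_pow_le1 j : half_pow j <= 1.
Proof. by apply: exprn_ile1; lra. Qed.

(** * Counting occupied cells *)

(** The number of distinct cells in a list of cells, a cell ]k - 1, k] being
    represented by the integer k. *)
Definition occ (s : seq int) : nat := size (undup s).

(** Exhibiting the old cells as images of the new ones bounds from below the
    number of cells left after a letter. *)
Lemma occ_le (f : int -> int) s s' :
  (forall k, k \in s -> exists2 k', k' \in s' & k = f k') -> (occ s <= occ s')%N.
Proof.
move=> sub; rewrite /occ -(size_map f (undup s')).
apply: uniq_leq_size (undup_uniq s) _.
move=> k; rewrite mem_undup => /sub[k' k's' ->].
by apply: map_f; rewrite mem_undup.
Qed.

(** As [occ_le], when one cell x may have been lost. *)
Lemma occ_le1 x (f : int -> int) s s' :
  (forall k, k \in s -> k = x \/ exists2 k', k' \in s' & k = f k') ->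
  (occ s <= (occ s').+1)%N.
Proof.
move=> sub; rewrite /occ -(size_map f (undup s')).
rewrite -[X in (_ <= X)%N]/(size (x :: map f (undup s'))).
apply: uniq_leq_size (undup_uniq s) _ => k; rewrite mem_undup inE.
case/sub=> [->|[k' k's' ->]]; first by rewrite eqxx.
by rewrite map_f ?orbT // mem_undup.
Qed.

Lemma occ_lt x s s' : x \notin s -> {subset x :: s <= s'} -> (occ s < occ s')%N.
Proof.
move=> xs sub; rewrite /occ -[X in (X <= _)%N]/(size (x :: undup s)).
apply: uniq_leq_size; first by rewrite /= mem_undup xs undup_uniq.
move=> k; rewrite inE !mem_undup => ks; apply: sub.
by rewrite inE.
Qed.

Lemma occ_cat s s' : (occ (s ++ s') <= occ s + size s')%N.
Proof.
rewrite /occ -size_cat; apply: uniq_leq_size (undup_uniq _) _ => k.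
by rewrite mem_undup !mem_cat mem_undup.
Qed.

(** The effect of x1^-1 on cells, and a section of it: cells 1 and 2 become
    cell 1, and [unmerge] picks cell 1 back. *)
Definition merge (k : int) : int := if k <= 1 then k else k - 1.
Definition unmerge (k : int) : int := if k <= 1 then k else k + 1.

Ltac merge_lia := rewrite ?/merge ?/unmerge; repeat (case: ifPn => ?); first [by [] | lia].

(** The relation between the cells of p and of [step a p].  It is not functional
    for x1, which may send a point of cell 1 to cell 1 or 2, but is then
    functional in the other direction. *)
Definition cell_step (a : letter) (k k' : int) : bool :=
  match a with
  | (false, false) => k' == k + 1
  | (false, true) => k' == k - 1
  | (true, false) => k == merge k'
  | (true, true) => k' == merge k
  end.

Lemma ceil_step a p : cell_step a (Num.ceil p) (Num.ceil (step a p)).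
Proof.
case: a => [[] []] /=; last 2 first.
- by rewrite ceilDrz // ceilN // ceil1.
- by rewrite ceilDrz // ceil1.
- have lt1 : (1 < Num.ceil p) = (1 < p) by exact: ceil_gt_int.
  have le2 : (Num.ceil p <= 2) = (p <= 2) by exact: ceil_le_int.
  have gt0 := ceil_gt0 p.
  case: (lerP p 0) => p0.
    by rewrite /merge; move: gt0; rewrite (le_gtF p0); merge_lia.
  case: (lerP p 2) => p2.
    have -> : Num.ceil (p / 2) = 1 by apply: ceil_def; lra.
    by move: le2 gt0; rewrite p2 p0; merge_lia.
  by rewrite ceilDrz // ceilN // ceil1 /merge; move: le2; rewrite (lt_geF p2); merge_lia.
have lt1 : (1 < Num.ceil p) = (1 < p) by exact: ceil_gt_int.
have gt0 := ceil_gt0 p.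
case: (lerP p 0) => p0.
  by rewrite /merge; move: gt0; rewrite (le_gtF p0); merge_lia.
case: (lerP p 1) => p1.
  have : (Num.ceil (p * 2) <= 2) = (p * 2 <= 2) by exact: ceil_le_int.
  have := ceil_gt0 (p * 2); rewrite pmulr_lgt0 // (_ : (p * 2 <= 2) = true); last lra.
  move: lt1 gt0; rewrite (le_gtF p1) p0.
  by move: (Num.ceil (p * 2)) (Num.ceil p) => c2 c1; merge_lia.
by move: lt1; rewrite p1 ceilDrz // ceil1; move: (Num.ceil p) => c; merge_lia.
Qed.

Definition cells (s : seq rat) (phi : rat -> rat) : seq int :=
  [seq Num.ceil (phi p) | p <- s].

Lemma cells_step a s phi k : k \in cells s phi ->
  exists2 k', k' \in cells s (step a \o phi) & cell_step a k k'.
Proof.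
case/mapP=> p ps ->; exists (Num.ceil (step a (phi p))); last exact: ceil_step.
exact: map_f.
Qed.

Lemma cells_cat s s' phi : cells (s ++ s') phi = cells s phi ++ cells s' phi.
Proof. exact: map_cat. Qed.

(** Only x1^-1 can merge cells, and it merges one pair. *)
Lemma occ_cells_step a s phi :
  (occ (cells s phi) <= occ (cells s (step a \o phi)) + (a == (true, true)))%N.
Proof.
case: a => [[] []]; rewrite ?addn0 ?addn1.
- apply: (@occ_le1 2 unmerge) => k /(cells_step (true, true))[k' ks' /= kk].
    case: (k =P 2) => [->|k2]; [by left | right; exists k' => //].
  by move: k2 kk; merge_lia.
- apply: (@occ_le merge) => k /(cells_step (true, false))[k' ks' /eqP ->].
  by exists k'.
- apply: (@occ_le (fun k => k + 1)) => k /(cells_step (false, true))[k' ks' /eqP kk].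
  by exists k' => //; rewrite kk subrK.
- apply: (@occ_le (fun k => k - 1)) => k /(cells_step (false, false))[k' ks' /eqP kk].
  by exists k' => //; rewrite kk addrK.
Qed.

(** Used while the left points A are being brought back and some right points
    remain to be cut, Q being those cut so far: points of A count as long as
    they lie right of the head. *)
Definition live (A Q : seq rat) (phi : rat -> rat) : seq int :=
  [seq k <- cells A phi | 0 < k] ++ cells Q phi.

(** For x0^-1 the only cell that can be lost is cell 1, which passes to the left
    of the head. *)
Lemma occ_live_step a A Q phi :
  (occ (live A Q phi) <= occ (live A Q (step a \o phi)) + a.2)%N.
Proof.
case: a => [[] []]; rewrite ?addn0 ?addn1.
- apply: (@occ_le1 2 unmerge) => k; rewrite mem_cat mem_filter.
  case: (k =P 2) => [->|k2]; first by left.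
  case/orP=> [/andP[k0]|] /(cells_step (true, true))[k' ks' /= kk];
    right; exists k'; rewrite ?mem_cat ?mem_filter ?ks' ?orbT //; move: k2 kk.
  + by rewrite andbT; move: k0; merge_lia.
  + by merge_lia.
  + by merge_lia.
- apply: (@occ_le merge) => k; rewrite mem_cat mem_filter.
  case/orP=> [/andP[k0]|] /(cells_step (true, false))[k' ks' /= /eqP kk];
    exists k'; rewrite ?mem_cat ?mem_filter ?ks' ?orbT //.
  by rewrite andbT; move: k0 kk; merge_lia.
- apply: (@occ_le1 1 (fun k => k + 1)) => k; rewrite mem_cat mem_filter.
  case: (k =P 1) => [->|k1]; first by left.
  case/orP=> [/andP[k0]|] /(cells_step (false, true))[k' ks' /= /eqP kk];
    right; exists k'; rewrite ?mem_cat ?mem_filter ?ks' ?orbT //; try lia.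
- apply: (@occ_le (fun k => k - 1)) => k; rewrite mem_cat mem_filter.
  case/orP=> [/andP[k0]|] /(cells_step (false, false))[k' ks' /= /eqP kk];
    exists k'; rewrite ?mem_cat ?mem_filter ?ks' ?orbT //; try lia.
Qed.

(** A cell carried across the head is not lost if it also contains a point of Q.
    Hence one letter x0^-1 cannot be charged both for carrying left points back
    and for moving a right point across the head. *)
Lemma occ_live_step_shared A Q phi : 1 \in cells Q phi ->
  (occ (live A Q phi) <= occ (live A Q (step (false, true) \o phi)))%N.
Proof.
move=> Q1; apply: (@occ_le (fun k => k + 1)) => k; rewrite mem_cat mem_filter.
have /(cells_step (false, true))[z zQ /= /eqP z0] := Q1.
case: (k =P 1) => [->|k1].
  by exists z; [rewrite mem_cat zQ orbT | rewrite z0].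
case/orP=> [/andP[k0]|] /(cells_step (false, true))[k' ks' /= /eqP kk];
  exists k'; rewrite ?mem_cat ?mem_filter ?ks' ?orbT //; try lia.
Qed.

(** The cells of Q on the left of the head: these remain to be brought back once
    all right points are cut. *)
Definition behind (Q : seq rat) (phi : rat -> rat) : seq int :=
  [seq k <- cells Q phi | k <= 0].

Lemma occ_behind_step a Q phi :
  (occ (behind Q phi) <= (occ (behind Q (step a \o phi))).+1)%N.
Proof.
pose f k : int := match a with
  | (false, false) => k - 1 | (false, true) => k + 1 | _ => k end.
apply: (@occ_le1 0 f) => k; rewrite mem_filter => /andP[k0].
case/(cells_step a)=> k' ks' kk; case: (k =P 0) => [->|k1]; [by left | right].
exists k'; rewrite ?mem_filter ?ks' ?andbT /f {f};
  by move: kk; case: a {ks'} => [[] []] /=; merge_lia.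
Qed.

(** The cells of A right of the head that contain no right point, c being the
    cell of the first right point. *)
Definition between (A : seq rat) (c : int) (phi : rat -> rat) : seq int :=
  [seq k <- cells A phi | 0 < k < c].

(** When c = 2, the letter x1^-1 merges cell 1 with the cell of the first right
    point; when c > 2, it merges cells 1 and 2.  Either way at
    most one cell is lost. *)
Lemma occ_between_step a A c c' phi : cell_step a c c' ->
  (occ (between A c phi) <= (occ (between A c' (step a \o phi))).+1)%N.
Proof.
pose f k : int := match a with
  | (false, false) => k - 1 | (false, true) => k + 1
  | (true, false) => merge k | (true, true) => unmerge k end.
pose x : int := if (c == 2) || (a == (false, true)) then 1 else 2.
move=> cc; apply: (@occ_le1 x f) => k.
rewrite mem_filter => /andP[k0] /(cells_step a)[k' ks' kk].
case: (k =P x) => [->|k1]; [by left | right].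
exists k'; rewrite ?mem_filter ?ks' ?andbT /f {f};
  move: kk cc k0 k1; rewrite /x; case: a {x ks'} => [[] []] /=;
  rewrite ?orbT ?orbF; merge_lia.
Qed.

(** * Cutting at the points q_j *)

(** The points 1 - 2^-(t+j) are q_(t+j).  As long as q_(t+1) has never been an
    integer, the interval [q_t, 1] has not been cut, and its image is a standard
    dyadic interval [k / 2^b, (k + 1) / 2^b], on which the action is affine.
    Keeping track of the points q_(t+j) is enough to remember this. *)
Definition dyadic_at (t : nat) (phi : rat -> rat) : Prop :=
  exists (k : int) (b : nat), forall j,
    phi (1 - half_pow (t + j)) = (k%:~R + 1 - half_pow j) * half_pow b.

Lemma half_pow_inv b : half_pow b * (2 ^+ b) = 1.
Proof. by rewrite /half_pow -exprMn mul1r mulVf ?expr1n. Qed.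

(** A standard dyadic interval lies inside one unit cell and, when its length is
    at most 1/2, inside one half cell; so it is cut only if it is [0, 1] itself
    and the letter is x1.  Then q_t is at the head and q_(t+1) is sent to 1. *)
Lemma dyadic_step a t phi : dyadic_at t phi ->
  dyadic_at t (step a \o phi) \/
  [/\ a = (true, false), phi (1 - half_pow t) = 0,
      step a (phi (1 - half_pow t.+1)) = 1 & dyadic_at t.+1 (step a \o phi)].
Proof.
case=> k [b phiE].
have b0 : 0 <= half_pow b by rewrite ltW ?half_pow_gt0.
have lo j : k%:~R * half_pow b <= phi (1 - half_pow (t + j)).
  rewrite phiE ler_wpM2r ?b0 //.
  by have := half_pow_le1 j; lra.
have hi j : phi (1 - half_pow (t + j)) <= (k + 1)%:~R * half_pow b.
  rewrite phiE ler_wpM2r ?b0 // intrD.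
  by have := half_pow_gt0 j; lra.
have geP (z : int) : z <= k -> z%:~R * half_pow b <= k%:~R * half_pow b.
  by move=> zk; rewrite ler_wpM2r ?b0 // ler_int.
have leP (z : int) : k < z -> (k + 1)%:~R * half_pow b <= z%:~R * half_pow b.
  by move=> zk; rewrite ler_wpM2r ?b0 // ler_int; lia.
have shift z : (forall j, step a (phi (1 - half_pow (t + j))) =
    phi (1 - half_pow (t + j)) + z%:~R) -> dyadic_at t (step a \o phi).
  move=> e; exists (k + z * 2 ^+ b), b => j; rewrite /= e phiE.
  rewrite intrD intrM rmorphXn /= !mulrDl -[_ * 2%:~R ^+ b * _]mulrA.
  by rewrite (mulrC (_ ^+ b)) half_pow_inv mulr1; ring.
have bE : (2 ^+ b)%:~R * half_pow b = 1.
  by rewrite rmorphXn /= mulrC half_pow_inv.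
case: a shift => [[] []] shift.
- left; case: (ltP k 0) => k0.
    by apply: (shift 0) => j; have := hi j; have := leP _ k0; rewrite /=; pl_lra.
  case: (ltP k (2 * 2 ^+ b)) => k2.
    exists k, b.+1 => j; rewrite /= half_powS mulrA -phiE.
    have := hi j; have := leP _ k2; have := lo j; have := geP _ k0.
    by rewrite intrM -mulrA bE; pl_lra.
  apply: (shift (-1)) => j; have := lo j; have := geP _ k2.
  by rewrite intrM -mulrA bE /=; pl_lra.
- case: (ltP k 0) => k0.
    by left; apply: (shift 0) => j; have := hi j; have := leP _ k0; rewrite /=; pl_lra.
  case: (ltP k (2 ^+ b)) => k1; last first.
    left; apply: (shift 1) => j; have := lo j; have := geP _ k1.
    by rewrite bE /=; pl_lra.
  case: b b0 phiE bE lo hi geP leP shift k1 =>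
    [|b] b0 phiE bE lo hi geP leP shift k1.
    (* The interval is [0, 1]: this is where the cut happens. *)
    have {}k0 : k = 0 by move: k1; rewrite expr0; lia.
    subst k; right.
    have phiE' j : phi (1 - half_pow (t + j)) = 1 - half_pow j.
      by rewrite phiE half_pow0; ring.
    have sE j : step (true, false) (phi (1 - half_pow (t.+1 + j))) = 2 - half_pow j.
      rewrite addSn -addnS phiE' half_powS.
      by have := half_pow_le1 j; have := half_pow_gt0 j; rewrite /=; pl_lra.
    split=> //.
    - by have := phiE' 0; rewrite addn0 half_pow0 => ->; lra.
    - by have := sE 0; rewrite addn0 half_pow0 => ->; lra.
    by exists 1, 0 => j; rewrite [LHS]sE half_pow0; ring.
  left; exists k, b => j /=.
  have := hi j; have := leP _ k1; have := lo j; have := geP _ k0.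
  have : phi (1 - half_pow (t + j)) = (k%:~R + 1 - half_pow j) * half_pow b / 2.
    by rewrite phiE half_powS mulrA.
  by rewrite bE mul0r; pl_lra.
- by left; apply: (shift (-1)) => j /=; rewrite rmorphN1.
- by left; apply: (shift 1) => j.
Qed.

(** The value is a dyadic number with odd numerator and denominator at least
    2. *)
Lemma dyadic_not_int t j phi : dyadic_at t phi ->
  phi (1 - half_pow (t + j.+1)) \isn't a Num.int.
Proof.
case=> k [b e]; apply/negP; rewrite e => /intrP[z].
move/(congr1 (fun x => x * 2 ^+ b * 2 ^+ j.+1)); rewrite -[_ * half_pow b * _]mulrA.
rewrite half_pow_inv mulr1 mulrBl half_pow_inv => h.
have : ((k + 1) * 2 ^+ j.+1 - 1 - z * 2 ^+ b * 2 ^+ j.+1)%:~R = 0 :> rat.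
  by rewrite !intrD !rmorphN /= !intrM !rmorphXn /= !intrD h; ring.
move/eqP; rewrite intr_eq0 !exprSr.
by move: (2 ^+ j) (2 ^+ b) => u v; lia.
Qed.

(** * The lower bound on word length *)

Definition left_pts (m : nat) : seq rat := [seq - i%:R | i <- iota 0 m.+1].
Definition right_pts (t : nat) : seq rat := [seq 1 - half_pow j | j <- iota 1 t].

(** The number of times that the head is known to have moved past a right point
    with a letter x0^-1, when q_1, ..., q_t have been cut: all of them except
    possibly q_t.  For t = 0 truncated subtraction gives 0 wherever the point
    q_0 = 0 has gone. *)
Definition crossed (t : nat) (phi : rat -> rat) : nat :=
  (t - (0 < phi (1 - half_pow t))%R)%N.

(** The potential, after l letters, in terms of the number t of right points
    already cut.
    - [LeftOpen]: the point -m has not yet been right of the head.  The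
      crossings count twice, since every x0^-1 must be compensated by an x0.
    - [LeftFirst]: -m has been right of the head, but the right points are not
      all cut.
    - [RightLast]: -m got right of the head before the right points were all
      cut; now they are, and those behind the head remain to be brought back.
    - [LeftLast]: the right points were all cut before -m first got right of the
      head, and the left points remain to be brought back. *)
Inductive phase (m M l t : nat) (phi : rat -> rat) : Prop :=
| LeftOpen r of phi (- m%:R) = - r%:R
    & (2 * m + 1 + 2 * t + 2 * crossed t phi <=
       l + occ (cells (left_pts m ++ right_pts t) phi) + r)%N
| LeftFirst of (t < M)%N
    & (2 * m + 2 + 2 * t + crossed t phi <=
       l + occ (live (left_pts m) (right_pts t) phi))%N
| RightLast of t = M & (2 * m + 3 * M <= l + occ (behind (right_pts M) phi))%N
| LeftLast of t = M
    & (2 * m + 3 * M <=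
       l + occ (between (left_pts m) (Num.ceil (phi (1 / 2)%R)) phi))%N.

Lemma left_ptsP m p : p \in left_pts m -> - m%:R <= p <= 0.
Proof.
case/mapP=> i; rewrite mem_iota => /andP[_ im] ->.
by rewrite lerN2 ler_nat oppr_le0 ler0n andbT.
Qed.

Lemma half_pow_anti i j : (i <= j)%N -> half_pow j <= half_pow i.
Proof. by move=> ij; rewrite ler_wiXn2l //; lra. Qed.

Lemma right_ptsP t p : p \in right_pts t -> 1 / 2 <= p <= 1 - half_pow t.
Proof.
case/mapP=> j; rewrite mem_iota => /andP[j0 jt] ->.
have := half_pow_anti j0; rewrite half_pow1.
have /half_pow_anti : (j <= t)%N by lia.
lra.
Qed.

Lemma right_ptsS t : right_pts t.+1 = rcons (right_pts t) (1 - half_pow t.+1).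
Proof. by rewrite /right_pts -[t.+1]addn1 iotaD map_cat cats1 addnC. Qed.

(** The last cut point q_t gets to the left of the head through x0^-1 only, and
    from the cell ]0, 1]. *)
Lemma crossed_step a t phi :
  (crossed t (step a \o phi) <=
   crossed t phi + ((a == (false, true)) && (1%R \in cells (right_pts t) phi)))%N.
Proof.
rewrite /crossed /=; set p := phi _.
have [->|t0] := posnP t; first by [].
have [p0|p0] := lerP p 0; first by rewrite subn0; lia.
have [p1|p1] := ltrP 0 (step a p); first lia.
have [ea p1'] : a = (false, true) /\ p <= 1.
  case: a p1 => [[] []] /= p1; last by exfalso; lra.
  - by exfalso; move: p1; pl_lra.
  - by exfalso; move: p1; pl_lra.
  by split=> //; lra.
rewrite ea eqxx.
suff -> : 1 \in cells (right_pts t) phi by lia.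
apply/mapP; exists (1 - half_pow t).
  by apply/mapP; exists t; rewrite // mem_iota; lia.
by apply/esym/ceil_def; rewrite -/p; lra.
Qed.

(** A left point never lies in a later cell than the first right point, and at
    most M cells contain right points. *)
Lemma occ_left_return m M (phi : rat -> rat) :
  {homo phi : p q / p < q} -> (0 < M)%N -> 0 < phi (- m%:R) ->
  (occ (cells (left_pts m ++ right_pts M) phi) <=
   occ (between (left_pts m) (Num.ceil (phi (1 / 2)%R)) phi) + M)%N.
Proof.
move=> /ltW_homo phi_le M0 a0; set c := Num.ceil _; rewrite cells_cat.
have cQ : c \in cells (right_pts M) phi.
  by apply: map_f; apply/mapP; exists 1; rewrite ?half_pow1 ?mem_iota //; lra.
apply: leq_trans (_ : occ (between (left_pts m) c phi ++ cells (right_pts M) phi) <= _)%N.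
  apply: (@occ_le id) => k; rewrite !mem_cat => /orP[/mapP[p pA ->]|kQ]; last first.
    by exists k; rewrite // mem_cat kQ orbT.
  have kA : Num.ceil (phi p) \in cells (left_pts m) phi by apply/mapP; exists p.
  exists (Num.ceil (phi p)); rewrite // mem_cat mem_filter kA.
  case/andP: (left_ptsP pA) => mp p0.
  have [->|kc] := eqVneq (Num.ceil (phi p)) c; first by rewrite cQ orbT.
  rewrite andbT ceil_gt0 (lt_le_trans a0) ?phi_le //= [_ < c]lt_neqAle kc /=.
  by rewrite le_ceil ?phi_le //; lra.
by apply: leq_trans (occ_cat _ _) _; rewrite !size_map size_iota.
Qed.

Lemma live_ahead (A Q : seq rat) phi : (forall p, p \in A -> 0 < phi p) ->
  live A Q phi = cells (A ++ Q) phi.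
Proof.
move=> A0; rewrite cells_cat /live (eq_in_filter (a2 := predT)) ?filter_predT //.
by move=> _ /mapP[p /A0 p0 ->]; rewrite ceil_gt0.
Qed.

(** A letter that cuts no new right point leaves t unchanged.  The passage out of
    [LeftOpen] occurs when an x0 takes the point -m from 0 to 1; all points are
    then right of the head. *)
Lemma phase_step a m M l t (phi : rat -> rat) :
  {homo phi : p q / p < q} -> (0 < M)%N -> (t <= M)%N ->
  phase m M l t phi -> phase m M l.+1 t (step a \o phi).
Proof.
move=> phi_lt M0 tM; set psi := step a \o phi.
have psi_lt : {homo psi : p q / p < q} by move=> p q /phi_lt; apply: step_lt.
have cs := crossed_step a t phi; rewrite -/psi in cs.
have cs1 : (crossed t psi <= crossed t phi + 1)%N.
  by apply: leq_trans cs _; rewrite leq_add2l leq_b1.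
have cs0 : a != (false, true) -> (crossed t psi <= crossed t phi)%N.
  by move=> /negbTE aN; rewrite aN addn0 in cs.
case=> [r e le|tM' le|tM' le|tM' le].
- have := occ_cells_step a (left_pts m ++ right_pts t) phi; rewrite -/psi => oc.
  clear cs; case: a @psi psi_lt cs0 cs1 oc => [[] []] psi psi_lt cs0 cs1 oc.
  + apply: (@LeftOpen _ _ _ _ _ r); last first.
      by have := cs0 isT; rewrite addn1 in oc; lia.
    by have := ler0n rat r; rewrite /psi /= e; pl_lra.
  + apply: (@LeftOpen _ _ _ _ _ r); last first.
      by have := cs0 isT; rewrite addn0 in oc; lia.
    by have := ler0n rat r; rewrite /psi /= e; pl_lra.
  + apply: (@LeftOpen _ _ _ _ _ r.+1); last first.
      by rewrite addn0 in oc; lia.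
    by rewrite /psi /= e -addn1 natrD opprD.
  rewrite addn0 in oc; have {}cs0 := cs0 isT.
  case: r e le => [|r] e le; last first.
    apply: (@LeftOpen _ _ _ _ _ r); last by lia.
    by rewrite /psi /= e -addn1 natrD; lra.
  (* The point -m crosses the head. *)
  have psi_m : psi (- m%:R) = 1 by rewrite /psi /= e oppr0 add0r.
  have pos p : p \in left_pts m ++ right_pts t -> 0 < psi p.
    move=> pAQ; apply: lt_le_trans (_ : 0 < psi (- m%:R)) _; first by rewrite psi_m.
    apply: (ltW_homo psi_lt); move: pAQ; rewrite mem_cat.
    case/orP=> [/left_ptsP/andP[] //|/right_ptsP/andP[p12 _]].
    by have : 0 <= m%:R :> rat; [|lra].
  have [tM'|tM'] := ltnP t M.
    apply: LeftFirst => //; rewrite live_ahead; first by lia.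
    by move=> p pA; apply: pos; rewrite mem_cat pA.
  have tE : t = M by lia.
  apply: LeftLast => //; have := occ_left_return (m := m) psi_lt M0.
  rewrite psi_m => /(_ ltr01); rewrite -tE; have : (t <= (crossed t psi).+1)%N.
    by rewrite /crossed; case: (X in nat_of_bool X); lia.
  move: le cs0 oc; move: (occ _) (occ _) (occ (between _ _ _)); lia.
- apply: LeftFirst => //.
  have := occ_live_step a (left_pts m) (right_pts t) phi; rewrite -/psi.
  case: (boolP ((a == (false, true)) && (1 \in cells (right_pts t) phi))) cs
    => [/andP[/eqP ea one]|_] cs.
    move=> _; have := occ_live_step_shared (left_pts m) one.
    by rewrite /psi ea /= in cs *; lia.
  by have : (a.2 <= 1)%N := leq_b1 _; lia.
- apply: RightLast => //.
  by have := occ_behind_step a (right_pts M) phi; rewrite -/psi; lia.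
apply: LeftLast => //.
have : (occ (between (left_pts m) (Num.ceil (phi (1 / 2)%R)) phi) <=
    (occ (between (left_pts m) (Num.ceil (psi (1 / 2)%R)) psi)).+1)%N.
  exact/occ_between_step/ceil_step.
by lia.
Qed.

(** When q_(t+1) is cut the head stands at q_t, so that all earlier points are on
    its left and x1 does not move them; the new integer point occupies cell 1,
    which was empty. *)
Lemma phase_split m M l t (phi : rat -> rat) :
  {homo phi : p q / p < q} -> (t < M)%N ->
  phi (1 - half_pow t) = 0 -> step (true, false) (phi (1 - half_pow t.+1)) = 1 ->
  phase m M l t phi -> phase m M l.+1 t.+1 (step (true, false) \o phi).
Proof.
move=> phi_lt tM q0 q1; set psi := _ \o phi.
have phi_le := ltW_homo phi_lt.
have A0 p : p \in left_pts m -> phi p <= 0.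
  case/left_ptsP/andP=> _ p0; rewrite -q0 phi_le //.
  by have := half_pow_le1 t; lra.
have Q0 p : p \in right_pts t -> phi p <= 0.
  by case/right_ptsP/andP=> _ pt; rewrite -q0 phi_le.
have same s : (forall p, p \in s -> phi p <= 0) -> cells s psi = cells s phi.
  by move=> s0; apply/eq_in_map => p /s0 p0; rewrite /psi /= p0.
have notin s : (forall p, p \in s -> phi p <= 0) -> 1 \notin cells s phi.
  by move=> s0; apply/mapP => -[p /s0]; rewrite -ceil_le0 => + e; rewrite -e.
have newQ : cells (right_pts t.+1) psi = rcons (cells (right_pts t) phi) 1.
  rewrite right_ptsS -!cats1 cells_cat (same _ Q0); congr (_ ++ _).
  by rewrite -(ceil1 rat) -[in RHS]q1.
have cr : crossed t phi = t by rewrite /crossed q0 ltxx subn0.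
have cr' : crossed t.+1 psi = t by rewrite /crossed [psi _]q1 ltr01 subn1.
case=> [r e le|_ le|tM'|tM']; try lia.
- apply: (@LeftOpen _ _ _ _ _ r); first by rewrite /psi /= e oppr_le0 ler0n.
  rewrite cr'; rewrite cr in le.
  suff : (occ (cells (left_pts m ++ right_pts t) phi) <
          occ (cells (left_pts m ++ right_pts t.+1) psi))%N by lia.
  apply: (@occ_lt 1).
    by apply: notin => p; rewrite mem_cat => /orP[/A0|/Q0].
  move=> k; rewrite !cells_cat newQ (same _ A0) inE !mem_cat mem_rcons inE.
  by case/or3P=> ->; rewrite ?orbT.
have liveE : live (left_pts m) (right_pts t) phi = cells (right_pts t) phi.
  rewrite /live (eq_in_filter (a2 := pred0)) ?filter_pred0 //.
  by move=> _ /mapP[p /A0 p0 ->]; rewrite ceil_gt0 le_gtF.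
rewrite liveE cr in le; have [tM'|tM'] := ltnP t.+1 M.
  apply: LeftFirst => //; rewrite cr'.
  suff : (occ (cells (right_pts t) phi) < occ (live (left_pts m) (right_pts t.+1) psi))%N.
    by lia.
  apply: (@occ_lt 1); first exact: notin.
  by move=> k; rewrite inE mem_cat newQ mem_rcons inE => ->; rewrite orbT.
have eM : M = t.+1 by lia.
apply: RightLast => //; rewrite eM.
suff : (occ (cells (right_pts t) phi) <= occ (behind (right_pts t.+1) psi))%N by lia.
apply: (@occ_le id) => k kQ; exists k => //.
rewrite mem_filter newQ mem_rcons inE kQ orbT andbT.
by case/mapP: kQ => p /Q0; rewrite -ceil_le0 => p0 ->.
Qed.

Lemma phase_nil m M : phase m M 0 0 (act [::]).
Proof.
apply: (@LeftOpen _ _ _ _ _ m) => //; rewrite cats0 /occ undup_id.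
  by rewrite !size_map size_iota /crossed; lia.
rewrite /cells -map_comp map_inj_uniq ?iota_uniq // => i j /=.
by rewrite !ceilN ?natr_int // !pmulrn !intrKceil => /oppr_inj [].
Qed.

Lemma phase_act m M w : (0 < M)%N -> exists t,
  [/\ (t <= M)%N, (t < M)%N -> dyadic_at t (act w) & phase m M (size w) t (act w)].
Proof.
move=> M0; elim/last_ind: w => [|w a [t [tM dt ph]]].
  exists 0%N; split=> //; last exact: phase_nil.
  by move=> _; exists 0, 0%N => j; rewrite half_pow0 add0r mulr1.
have -> : act (rcons w a) = step a \o act w by apply/funext => p; rewrite act_rcons.
rewrite size_rcons; have w_lt := @act_lt w.
have stay := phase_step a w_lt M0 tM ph.
have [tM'|tM'] := ltnP t M; last by exists t; split=> // ?; lia.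
have [dt'|[ea q0 q1 dt']] := dyadic_step a (dt tM').
  by exists t; split.
exists t.+1; split=> //; rewrite ea in q1 *.
exact: phase_split.
Qed.

(** The conditions at -m and at q_M say that the work at the far left and at the
    far right has been done, and those at 0 and at q_1 = 1/2 that the head is
    between the left and the right points: either 0 is left of the head, or all
    left points right of the head share a cell with q_1. *)
Lemma word_lower_bound m M w : (0 < M)%N ->
  act w (- m%:R) \isn't a Num.int ->
  act w (1 - half_pow M) \is a Num.int ->
  0 < act w (1 / 2) ->
  act w 0 <= 0 \/ act w (1 / 2) <= 1 ->
  (2 * m + 3 * M <= size w)%N.
Proof.
move=> M0 aN qI q0 sep; have [t [tM dt]] := phase_act m w M0.
have {dt}tM' : ~ (t < M)%N.
  move=> lt; have := dyadic_not_int (M - t).-1 (dt lt).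
  by rewrite prednK ?subn_gt0 // subnKC // qI.
have occ0 s : (forall k, k \notin s) -> occ s = 0%N.
  by case: s => [|k s] // /(_ k); rewrite mem_head.
case=> [r e|//|_|_].
- by move: aN; rewrite e rpredN natr_int.
- rewrite occ0 ?addn0 // => k; rewrite mem_filter; apply/andP => -[k0 /mapP[p pQ ek]].
  move: k0; rewrite ek ceil_le0 leNgt (lt_le_trans q0) ?act_le //.
  by case/andP: (right_ptsP pQ).
rewrite occ0 ?addn0 // => k; rewrite mem_filter.
apply/andP => -[/andP[k0 kc] /mapP[p /left_ptsP/andP[_ p0] ek]].
case: sep => [s0|s1].
  by move: k0; rewrite ek ceil_gt0 ltNge (le_trans _ s0) ?act_le.
suff : Num.ceil (act w (1 / 2)) <= 1 by lia.
by rewrite ceil_le_int.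
Qed.

(** * Two elements at distance 2 *)

Lemma act_nseq0 k p : act (nseq k (false, false)) p = p + k%:R.
Proof. by elim: k p => [|k IHk] p /=; rewrite ?addr0 // IHk -addn1 natrD; ring. Qed.

Lemma act_nseq0V k p : act (nseq k (false, true)) p = p - k%:R.
Proof. by elim: k p => [|k IHk] p /=; rewrite ?subr0 // IHk -addn1 natrD; ring. Qed.

Lemma act_comb_le0 k j p : p <= 0 -> act (comb k j) p = p - k%:R + j%:R.
Proof.
move=> p0; rewrite act_cat /= act_nseq0.
have -> : act (flatten (nseq k [:: (true, false); (false, true)])) p = p - k%:R.
  elim: k p p0 => [|k IHk] p p0 /=; first by rewrite subr0.
  by rewrite p0 IHk ?mulrSr; [ring | lra].
by rewrite ifT // lerBlDr; apply: le_trans p0 _; rewrite add0r.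
Qed.

Lemma act_comb_tail k i j :
  act (comb k j) (1 - half_pow (k + i).+1) =
  act ((true, false) :: nseq j (false, false)) (1 - half_pow i.+1).
Proof.
rewrite act_cat; congr (act _ _).
elim: k => //= k IHk; rewrite -[RHS]IHk; congr (act _ _).
rewrite addSn half_powS; have := half_pow_gt0 (k + i).+1.
have := half_pow_le1 (k + i).+1.
move=> ? ?; pl_lra.
Qed.

Lemma act_comb_split k j : act (comb k j) (1 - half_pow k.+1) = 1 + j%:R.
Proof.
have := act_comb_tail k 0 j; rewrite addn0 half_pow1 => ->.
by rewrite -cat1s act_cat act_nseq0 [act [:: _] _]/act [foldl _ _ _]/step; pl_lra.
Qed.

Lemma act_hook_far i j p : 1 - i%:R < p -> 2 <= p + i%:R ->
  act (hook i j) p = p + i%:R - 1 - j%:R.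
Proof.
by move=> ? ?; rewrite act_cat /= act_nseq0 act_nseq0V; pl_lra.
Qed.

Lemma act_hook_edge j : act (hook j.+1 j) (- j%:R) = 1 / 2 - j%:R.
Proof.
by rewrite act_cat act_nseq0 -addn1 natrD addKr /= act_nseq0V.
Qed.

Lemma step_far_left a p : p <= -1 ->
  exists2 z : int, step a p = p + z%:~R & step a p <= p + 1.
Proof.
move=> p1; case: a => [[] []] /=.
- by exists 0; pl_lra.
- by exists 0; pl_lra.
- by exists (-1); lra.
- by exists 1; lra.
Qed.

(** Each letter moves a point at most one unit to the right, and letters act left
    of the head by integer translations. *)
Lemma act_far_left w p : p <= - (size w)%:R -> p \isn't a Num.int ->
  act w p \isn't a Num.int.
Proof.
elim: w p => //= a w IHw p; rewrite -addn1 natrD => pw pN.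
have w0 : 0 <= (size w)%:R :> rat by [].
have [|z ez le] := @step_far_left a p; first lra.
apply: IHw; first lra.
by rewrite ez rpredDr // intr_int.
Qed.

Lemma act_far_right w p : 1 + (size w)%:R <= p -> p \is a Num.int ->
  act w p \is a Num.int.
Proof.
elim: w p => //= a w IHw p; rewrite -addn1 natrD => pw pI.
have w0 : 0 <= (size w)%:R :> rat by [].
have [] : step a p = p + 1 \/ step a p = p - 1.
- by case: a => [[] []] /=; do ?[by left | by right];
    [right | left]; pl_lra.
- by move=> ->; apply: IHw; [lra | rewrite rpredD].
by move=> ->; apply: IHw; [lra | rewrite rpredB].
Qed.

(** Take the first vertex where q_1 = 1/2 is right of the head; there is one,
    since 0 gets there and q_1 is ahead of 0.  If 0 is right of the head too,
    then an x0 has just moved 0 and q_1 across the head together, in one cell. *)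
Lemma path_crossing p g : path (cayley X) g p ->
  gact g 0 <= 0 -> 0 < gact (last g p) 0 ->
  exists h w, [/\ h \in g :: p, h = (g * eval w)%g, (size w <= size p)%N,
    0 < gact h (1 / 2) & gact h 0 <= 0 \/ gact h (1 / 2) <= 1].
Proof.
elim: p g => [|h p IHp] g /=; first by move=> _ ? ?; lra.
move=> gp g0 l0; have [g12|g12] := ltrP 0 (gact g (1 / 2)).
  exists g, [::]; split=> //; [exact: mem_head| by rewrite eval_nil mulg1 | by left].
case/andP: gp => /cayleyP[a eh] hp; have [h0|h0] := lerP (gact h 0) 0.
  have [k [w [kp ek sw]]] := IHp h hp h0 l0.
  case=> *; exists k, (a :: w); split=> //; first by rewrite inE kp orbT.
  by rewrite -cat1s eval_cat mulgA -eh.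
have eq q : gact h q = step a (gact g q) by rewrite eh gactM gact_eval.
have lt : gact h 0 < gact h (1 / 2) by apply: act_lt; lra.
exists h, [:: a]; split=> //; first by rewrite !inE eqxx orbT.
  lra.
right; move: h0; rewrite !eq; case: a {eh eq lt} => [[] []] /=; pl_lra.
Qed.

Lemma eval_combS k j : eval (comb k j.+1) = (eval (comb k j) * thompson_x0)%g.
Proof. by rewrite !eval_comb (expgSr thompson_x0) !mulgA. Qed.

Lemma eval_hookS i j : eval (hook i j) = (eval (hook i j.+1) * thompson_x0)%g.
Proof. by rewrite !eval_hook expgS invgM !mulgA mulgVK. Qed.

Lemma commute_around (G : groupType) (t c c' h h' : G) :
  commute c h -> c = (c' * t)%g -> h' = (h * t)%g ->
  (c * h' = h * c' * (t * t))%g.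
Proof. by move=> ch ec ->; rewrite mulgA ch ec !mulgA. Qed.

Theorem theorem1p1 : ~ almost_convex thompsonF_generating 2.
Proof.
case=> N AC.
(* Here m = N + 1 and M = N + 3, so that n = 2m + 3M - 1 = 5N + 10; N letters
   cannot bring the head from y to the point -m or to q_M. *)
pose y := (eval (hook N.+2 N.+1) * eval (comb N.+2 N.+1))%g.
pose z := (eval (comb N.+2 N.+2) * eval (hook N.+2 N))%g.
have yB : ball thompsonF_generating (5 * N + 10) y.
  apply/ballP; exists (hook N.+2 N.+1 ++ comb N.+2 N.+1); last by rewrite eval_cat.
  by rewrite size_cat size_comb size_hook; lia.
have zB : ball thompsonF_generating (5 * N + 10) z.
  apply/ballP; exists (comb N.+2 N.+2 ++ hook N.+2 N); last by rewrite eval_cat.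
  by rewrite size_cat size_comb size_hook; lia.
have yz : z = (y * eval [:: (false, false); (false, false)])%g.
  rewrite eval_cons eval_letter; apply: commute_around;
    [|exact: eval_combS|exact: eval_hookS].
  exact: comb_hook_commute.
have N0 : 0 <= N%:R :> rat by [].
have e1 : N.+1%:R = N%:R + 1 :> rat by rewrite -addn1 natrD.
have e2 : N.+2%:R = N%:R + 2 :> rat by rewrite -addn2 natrD.
have yE p : gact y p = act (comb N.+2 N.+1) (act (hook N.+2 N.+1) p).
  by rewrite gactM !gact_eval.
have hookE p : 0 <= p -> act (hook N.+2 N.+1) p = p.
  by move=> p0; rewrite act_hook_far e2 ?e1; lra.
have y0 : gact y 0 = -1.
  by rewrite yE hookE // act_comb_le0 // e1 e2; lra.
have z0 : gact z 0 = 1.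
  by rewrite yz gactM y0 gact_eval /act [foldl _ _ _]/=; lra.
have yA : gact y (- N.+1%:R) = - 1 / 2 - N.+1%:R.
  by rewrite yE act_hook_edge act_comb_le0 e1 ?e2; lra.
have yQ : gact y (1 - half_pow N.+3) = 1 + N.+1%:R.
  rewrite yE hookE; first exact: act_comb_split.
  have := half_pow_le1 N.+3; lra.
have [||p [pP pl ps pB]] := AC (5 * N + 10)%N _ y z yB zB.
- by lia.
- by rewrite yz; apply: word_metric_le.
have [||h [w [hp eh ws h12 h0]]] := path_crossing pP.
- by rewrite y0.
- by rewrite pl z0.
have /ballP[u us eu] := allP pB _ hp.
(* The crossing vertex would have length at most n. *)
have : (2 * N.+1 + 3 * N.+3 <= size u)%N; last by lia.
have wN : (size w)%:R <= N%:R :> rat by rewrite ler_nat; lia.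
rewrite eu !gact_eval in h12 h0; apply: word_lower_bound => //.
- rewrite -gact_eval -eu eh gactM gact_eval yA.
  apply: act_far_left; first by rewrite e1; lra.
  by rewrite rpredBr ?natr_int.
- rewrite -gact_eval -eu eh gactM gact_eval yQ.
  apply: act_far_right; last by rewrite rpredD ?natr_int.
  by rewrite e1; lra.
Qed.
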